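(* Let $n\ge 1$ and let 2-CAT denote the caterpillar on $3^n$ vertices whose backbone is a path on $3^{n-1}$ vertices, each backbone vertex having exactly two additional pendant leaves. Then \[WL(Q_n^3, \text{2-CAT})=2(3^{n-1})(3^{n-1}-1)+(4n)(3^{n-1}).\]
   Context: $Q_n^3$ is the graph on $\{0,1,2\}^n$ in which two tuples are adjacent iff they differ in exactly one coordinate $j$ and there $x_j\equiv y_j\pm1\pmod 3$. For graphs $G$ and a tree $T$ with $|V(G)|=|V(T)|$ and a bijection $f:V(G)\to V(T)$, $WL_f(G,T)$ is the sum over edges $(u,v)$ of $G$ of the distance in $T$ between $f(u)$ and $f(v)$; $WL(G,T)=\min_f WL_f(G,T)$. *)

(* Defs.v *)
From HB Require Import structures.
From mathcomp Require Import all_boot all_order all_algebra.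

Set Implicit Arguments.
Unset Strict Implicit.
Unset Printing Implicit Defensive.

Record sgraph := SGraph {
  vertex :> finType;
  adj : rel vertex;
  adj_sym : symmetric adj;
  adj_irr : irreflexive adj }.

(* Least k such that some walk with k edges joins x to y. In a connected graph
   this k is smaller than #|G|; the value is #|G| if no walk joins x to y. *)
Definition dist (G : sgraph) (x y : G) : nat :=
  find (fun k => [exists p : k.-tuple G, path (@adj G) x p && (last x p == y)])
       (iota 0 #|G|).

(* The condition on enum_rank makes the sum count each undirected edge once. *)
Definition WLf (G T : sgraph) (f : G -> T) : nat :=
  \sum_(e : G * G | adj e.1 e.2 && (enum_rank e.1 < enum_rank e.2))
     dist (f e.1) (f e.2).

Definition bijectiveb (V W : finType) (f : V -> W) : bool :=
  injectiveb f && [forall w, w \in codom f].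

Definition WL_attained (G T : sgraph) : pred nat :=
  fun w => [exists f : {ffun G -> T}, bijectiveb f && (WLf f == w)].

Lemma WL_attained_ex (G T : sgraph) :
  #|G| = #|T| -> exists w, WL_attained G T w.
Proof.
move=> h; pose g (x : G) : T := enum_val (cast_ord h (enum_rank x)).
have g_inj : injective g.
  by move=> x y /enum_val_inj /cast_ord_inj /enum_rank_inj.
exists (WLf (finfun g)); apply/existsP; exists (finfun g).
rewrite eqxx andbT; apply/andP; split.
  by apply/injectiveP => x y; rewrite !ffunE => /g_inj.
apply/forallP => w; apply/codomP.
exists (enum_val (cast_ord (esym h) (enum_rank w))).
by rewrite ffunE /g enum_valK cast_ordKV enum_rankK.
Qed.

Definition WL (G T : sgraph) (h : #|G| = #|T|) : nat :=
  ex_minn (WL_attained_ex h).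

Arguments WL : clear implicits.

Section TernaryCube.
Variable n : nat.

(* 'I_3 carries the ring structure of the integers modulo 3. *)
Definition Q3_adj (x y : {ffun 'I_n -> 'I_3}) : bool :=
  [exists j, [forall i, (x i != y i) == (i == j)]
             && ((x j == y j + 1)%R || (x j == y j - 1)%R)].

Lemma Q3_adj_sym : symmetric Q3_adj.
Proof.
suff H x y : Q3_adj x y -> Q3_adj y x by move=> x y; apply/idP/idP; apply: H.
move=> /existsP[j /andP[/forallP d xy]]; apply/existsP; exists j.
apply/andP; split; first by apply/forallP => i; rewrite eq_sym [y i == _]eq_sym eq_sym.
by case/orP: xy => /eqP->; rewrite ?GRing.addrK ?GRing.subrK eqxx ?orbT.
Qed.

Lemma Q3_adj_irr : irreflexive Q3_adj.
Proof.
move=> x; apply/negbTE/negP => /existsP[j /andP[/forallP/(_ j)]].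
by rewrite !eqxx.
Qed.

Definition Q3 : sgraph := SGraph Q3_adj_sym Q3_adj_irr.

End TernaryCube.

Section Caterpillar.
Variables m k : nat.

(* inl i is the i-th backbone vertex; inr (i, l) is the l-th leaf attached to
   it. *)
Definition cat_adj (x y : 'I_m + 'I_m * 'I_k) : bool :=
  match x, y with
  | inl i, inl j => (i.+1 == j :> nat) || (j.+1 == i :> nat)
  | inl i, inr (j, _) => i == j
  | inr (j, _), inl i => i == j
  | inr _, inr _ => false
  end.

Lemma cat_adj_sym : symmetric cat_adj.
Proof. by move=> [i|[i a]] [j|[j b]] //=; rewrite orbC. Qed.

Lemma cat_adj_irr : irreflexive cat_adj.
Proof. by move=> [i|[i a]] //=; rewrite orbb gtn_eqF. Qed.

Definition caterpillar : sgraph := SGraph cat_adj_sym cat_adj_irr.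

End Caterpillar.

Definition twoCAT (n : nat) : sgraph := caterpillar (3 ^ (n - 1)) 2.

Lemma card_Q3_twoCAT (n : nat) : 1 <= n -> #|Q3 n| = #|twoCAT n|.
Proof.
case: n => // n _; rewrite card_ffun !card_ord card_sum card_prod !card_ord.
by rewrite subn1 /= expnS -mulnS mulnC.
Qed.

(* Main.v *)
Require Import Defs.
From HB Require Import structures.
From mathcomp Require Import all_boot all_order all_algebra.
From mathcomp Require Import zify.

(** The length of a layout is the sum, over the edges of the tree, of the number
    of cube edges that the tree edge separates. A pendant edge separates one
    vertex and always contributes 2n. The i-th backbone edge separates 3i
    vertices, and by Lindsey's edge-isoperimetric theorem a set of s vertices
    spans at most [lex_edges s] edges, the number spanned by the first s vertices
    in lexicographic order; summing 2n(3i) - 2 [lex_edges (3i)] gives the lower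
    bound. Laying out the cube in lexicographic order, three consecutive vertices
    per backbone vertex, attains it. *)

(** * Edges spanned by lexicographic initial segments *)

(** The first argument is fuel; [i] units suffice, as [i] has at most [i] ternary digits. *)
Fixpoint digit_sum3_rec (k i : nat) : nat :=
  if k is k'.+1 then i %% 3 + digit_sum3_rec k' (i %/ 3) else 0.

Definition digit_sum3 (i : nat) : nat := digit_sum3_rec i i.

(* Vertex number i in lexicographic order has [digit_sum3 i] smaller neighbours. *)
Definition lex_edges (m : nat) : nat := \sum_(i < m) digit_sum3 i.

Lemma digit_sum3_rec_stable k l i :
  i <= k -> i <= l -> digit_sum3_rec k i = digit_sum3_rec l i.
Proof.
elim: k l i => [|k IH] [|l] i ik il //=.
- have -> : i = 0 by lia.
  by elim: l {il} => //= l <-.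
- have -> : i = 0 by lia.
  by rewrite (IH 0).
- by congr (_ + _); apply: IH; lia.
Qed.

Lemma digit_sum3_step q r : r < 3 -> digit_sum3 (3 * q + r) = digit_sum3 q + r.
Proof.
move=> r3; case: (posnP (3 * q + r)) => [e0|pos].
  by have [-> ->] : q = 0 /\ r = 0 by lia.
rewrite /digit_sum3; case e: (3 * q + r) pos => [//|k] _ /=; rewrite -e.
have -> : (3 * q + r) %% 3 = r by lia.
have -> : (3 * q + r) %/ 3 = q by lia.
by rewrite addnC (digit_sum3_rec_stable k q) //; lia.
Qed.

(** Without a carry only the last digit grows; a carry drops it from 2 to 0, and induction bounds
    the gain in the other digits. *)
Lemma digit_sum3S i : digit_sum3 i.+1 <= (digit_sum3 i).+1.
Proof.
elim/ltn_ind: i => i IH.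
have ei : i = 3 * (i %/ 3) + i %% 3 by lia.
have r3 : i %% 3 < 3 by lia.
case: (ltnP (i %% 3) 2) => r2.
  rewrite {1 2}ei -addnS !digit_sum3_step //; lia.
have -> : i.+1 = 3 * (i %/ 3).+1 + 0 by lia.
rewrite {2}ei !digit_sum3_step //.
case: (posnP i) => [i0|ipos]; first by rewrite i0 in r2.
have := IH (i %/ 3); lia.
Qed.

Lemma lex_edgesS m : lex_edges m.+1 = lex_edges m + digit_sum3 m.
Proof. by rewrite /lex_edges big_ord_recr. Qed.

Lemma lex_edges0 : lex_edges 0 = 0.
Proof. by rewrite /lex_edges big_ord0. Qed.

(** The numbers below [3 * q + r] form [q] full triples, with last digits adding 0 + 1 + 2 in each,
    and [r] numbers with leading part [q], whose last digits add up to [r == 2]. *)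
Lemma lex_edges_step q r : r < 3 ->
  lex_edges (3 * q + r) = 3 * lex_edges q + 3 * q + r * digit_sum3 q + (r == 2).
Proof.
have aux p : lex_edges (3 * p) = 3 * lex_edges p + 3 * p.
  elim: p => [|p IH]; first by rewrite muln0 lex_edges0.
  have -> : 3 * p.+1 = (3 * p + 2).+1 by lia.
  rewrite lex_edgesS [3 * p + 2]addn2 2!lex_edgesS IH lex_edgesS.
  have -> : digit_sum3 (3 * p) = digit_sum3 p.
    by rewrite -[3 * p]addn0 digit_sum3_step // addn0.
  have -> : digit_sum3 (3 * p).+1 = digit_sum3 p + 1.
    by rewrite -(addn1 (3 * _)) digit_sum3_step.
  rewrite -(addn2 (3 * p)) digit_sum3_step //; lia.
have h0 : digit_sum3 (3 * q) = digit_sum3 q.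
  by rewrite -[3 * q]addn0 digit_sum3_step // addn0.
have h1 : digit_sum3 (3 * q).+1 = digit_sum3 q + 1.
  by rewrite -(addn1 (3 * _)) digit_sum3_step.
case: r => [|[|[|//]]] _; rewrite ?addn0 ?addn1 ?addn2 ?lex_edgesS aux ?h0 ?h1 /=; lia.
Qed.

(** Group the numbers below [a] by last digit 0, 1, 2: the quotients in each group form an initial
    segment, and the last digits give the two linear terms. *)
Lemma lex_edges_slices a :
  lex_edges a = lex_edges ((a + 2) %/ 3) + lex_edges ((a + 1) %/ 3)
    + lex_edges (a %/ 3) + (a + 1) %/ 3 + 2 * (a %/ 3).
Proof.
have r3 : a %% 3 < 3 by lia.
have {1}-> : a = 3 * (a %/ 3) + a %% 3 by lia.
rewrite lex_edges_step //.
case e: (a %% 3) r3 => [|[|[|//]]] _ /=.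
- have -> : (a + 2) %/ 3 = a %/ 3 by lia.
  have -> : (a + 1) %/ 3 = a %/ 3 by lia.
  lia.
- have -> : (a + 2) %/ 3 = (a %/ 3).+1 by lia.
  have -> : (a + 1) %/ 3 = a %/ 3 by lia.
  rewrite lex_edgesS; lia.
- have -> : (a + 2) %/ 3 = (a %/ 3).+1 by lia.
  have -> : (a + 1) %/ 3 = (a %/ 3).+1 by lia.
  rewrite lex_edgesS; lia.
Qed.

(** A spread of 3 is what regrouping three segments by last digit leaves, rounding costing at most 1
    per segment. With [a = c + k], [b = c + l], everything expands in digit sums of [c], [c.+1],
    [c.+2], which [digit_sum3S] compares. *)
Lemma lex_edges_superadd_near a b c : c <= b -> b <= a -> a <= c + 3 ->
  lex_edges a + lex_edges b + lex_edges c + b + 2 * c <= lex_edges (a + b + c).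
Proof.
move=> cb ba ac.
have I0 := lex_edges_step c 0 isT; have I1 := lex_edges_step c 1 isT.
have I2 := lex_edges_step c 2 isT; have I3 := lex_edges_step c.+1 0 isT.
have I4 := lex_edges_step c.+1 1 isT; have I5 := lex_edges_step c.+1 2 isT.
have I6 := lex_edges_step c.+2 0 isT.
have J1 := lex_edgesS c; have J2 := lex_edgesS c.+1; have J3 := lex_edgesS c.+2.
have s1 := digit_sum3S c; have s2 := digit_sum3S c.+1.
move: I0 I1 I2 I3 I4 I5 I6.
have -> : 3 * c.+1 + 0 = 3 * c + 3 by lia.
have -> : 3 * c.+1 + 1 = 3 * c + 4 by lia.
have -> : 3 * c.+1 + 2 = 3 * c + 5 by lia.
have -> : 3 * c.+2 + 0 = 3 * c + 6 by lia.
rewrite /= => I0 I1 I2 I3 I4 I5 I6.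
have [k ek] : exists k, a = c + k by exists (a - c); lia.
have [l el] : exists l, b = c + l by exists (b - c); lia.
have -> : a + b + c = 3 * c + (k + l) by lia.
have k3 : k <= 3 by lia.
have lk : l <= k by lia.
move: ek el; case: k k3 lk => [|[|[|[|//]]]] _; case: l => [|[|[|[|//]]]] // _ -> ->;
  rewrite ?[c + 0]addn0 ?[c + 1]addn1 ?[c + 2]addn2 ?[c + 3]addn3;
  rewrite ?addSn ?add0n; lia.
Qed.

(* Cutting each of the three segments by last digit and regrouping the nine
   pieces by that digit gives three segments whose sizes differ by at most 3,
   where the inequality is a finite check. *)
Lemma lex_edges_superadd_sorted a b c : c <= b -> b <= a ->
  lex_edges a + lex_edges b + lex_edges c + b + 2 * c <= lex_edges (a + b + c).
Proof.
elim/ltn_ind: a b c => a IH b c cb ba.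
case: (leqP a (c + 3)) => [|ca]; first exact: lex_edges_superadd_near.
have h0 := IH ((a + 2) %/ 3) _ ((b + 2) %/ 3) ((c + 2) %/ 3) _ _.
have h1 := IH ((a + 1) %/ 3) _ ((b + 1) %/ 3) ((c + 1) %/ 3) _ _.
have h2 := IH (a %/ 3) _ (b %/ 3) (c %/ 3) _ _.
have {}h0 := h0 ltac:(lia) ltac:(lia) ltac:(lia).
have {}h1 := h1 ltac:(lia) ltac:(lia) ltac:(lia).
have {}h2 := h2 ltac:(lia) ltac:(lia) ltac:(lia).
have := lex_edges_superadd_near ((a + 2) %/ 3 + (b + 2) %/ 3 + (c + 2) %/ 3)
  ((a + 1) %/ 3 + (b + 1) %/ 3 + (c + 1) %/ 3) (a %/ 3 + b %/ 3 + c %/ 3).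
move=> /(_ ltac:(lia) ltac:(lia) ltac:(lia)).
have -> : (a + 2) %/ 3 + (b + 2) %/ 3 + (c + 2) %/ 3 +
  ((a + 1) %/ 3 + (b + 1) %/ 3 + (c + 1) %/ 3) + (a %/ 3 + b %/ 3 + c %/ 3)
  = a + b + c by lia.
rewrite (lex_edges_slices a) (lex_edges_slices b) (lex_edges_slices c).
lia.
Qed.

(** Numerical core of the induction on dimension: [a], [b], [c] will be the sizes of three slices,
    and each minimum bounds the edges between two of them. *)
Lemma lex_edges_superadd a b c :
  lex_edges a + lex_edges b + lex_edges c + minn a b + minn a c + minn b c
    <= lex_edges (a + b + c).
Proof.
wlog ab : a b c / b <= a => [h|].
  case/orP: (leq_total b a) => ba; first exact: h.
  by have := h b a c ba; rewrite (addnC b a) (minnC b a); lia.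
wlog bc : a b c ab / c <= b => [h|].
  case/orP: (leq_total c b) => bc; first exact: h.
  case/orP: (leq_total c a) => ca.
    have := h a c b ca bc; rewrite (minnC c b).
    have -> : a + c + b = a + b + c by lia.
    lia.
  have := h c a b ca ab.
  have -> : c + a + b = a + b + c by lia.
  rewrite (minnC c a) (minnC c b); lia.
have := lex_edges_superadd_sorted a b c bc ab; lia.
Qed.

Lemma lex_edges_exp m : lex_edges (3 ^ m) = m * 3 ^ m.
Proof.
elim: m => [|m IH]; first by rewrite lex_edgesS lex_edges0.
rewrite expnS -[3 * _]addn0 lex_edges_step // IH; lia.
Qed.

Lemma sum_lex_edges_step N :
  \sum_(i < 3 * N) lex_edges i =
    9 * (\sum_(i < N) lex_edges i) + 3 * lex_edges N + 9 * (\sum_(i < N) i) + N.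
Proof.
elim: N => [|N IH]; first by rewrite muln0 !big_ord0 lex_edges0.
have -> : 3 * N.+1 = (3 * N).+3 by lia.
rewrite !big_ord_recr /= IH (lex_edgesS N).
have := lex_edges_step N 0 isT; have := lex_edges_step N 1 isT.
have := lex_edges_step N 2 isT.
rewrite /= (addn0 (3 * N)) (addn1 (3 * N)) (addn2 (3 * N)); lia.
Qed.

Lemma double_sum_ord N : 2 * (\sum_(i < N) i) = N * (N - 1).
Proof.
elim: N => [|N IH]; first by rewrite big_ord0.
rewrite big_ord_recr /= mulnDr IH; case: N {IH} => [//|N].
rewrite !subn1 /=; nia.
Qed.

Lemma sum_lex_edges_exp m :
  6 * (\sum_(i < 3 ^ m) lex_edges i) + 2 * 3 ^ m * (3 ^ m - 1) =
  3 * m * 3 ^ m * (3 ^ m - 1).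
Proof.
elim: m => [|m IH]; first by rewrite big_ord_recr big_ord0 lex_edges0.
rewrite expnS sum_lex_edges_step lex_edges_exp.
have := double_sum_ord (3 ^ m); have := expn_gt0 3 m.
move: IH; set X := \sum_(i < _) _; set Y := \sum_(i < _) _; set N := 3 ^ m.
case: N => [//|N]; rewrite !subn1 /= => IH _ hY.
nia.
Qed.

(** Evaluates the lower bound summed over the backbone in dimension [m.+1], written without
    subtraction. *)
Lemma sum_lex_edges_mul3 m :
  2 * (\sum_(i < 3 ^ m) lex_edges (3 * i)) + 2 * 3 ^ m * (3 ^ m - 1) =
  6 * m.+1 * (\sum_(i < 3 ^ m) i).
Proof.
have -> : \sum_(i < 3 ^ m) lex_edges (3 * i) =
    3 * (\sum_(i < 3 ^ m) lex_edges i) + 3 * (\sum_(i < 3 ^ m) i).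
  rewrite !big_distrr -big_split /=; apply: eq_bigr => i _.
  by have := lex_edges_step i 0 isT; rewrite !addn0.
have := sum_lex_edges_exp m; have := double_sum_ord (3 ^ m).
set X := \sum_(i < _) _; set Y := \sum_(i < _) _ => hX hY.
nia.
Qed.

(** * Isoperimetry in the ternary cube *)

Local Notation cube n := {ffun 'I_n -> 'I_3}.

Definition hamming {n} (x y : cube n) : nat := \sum_(i < n) (x i != y i).

(** Distinct residues modulo 3 always differ by 1 or -1, so only the number of differing coordinates
    matters. *)
Lemma Q3_adjE n (x y : cube n) : Q3_adj x y = (hamming x y == 1).
Proof.
apply/existsP/sum_nat_eq1 => [[j /andP[/forallP d _]]|[j [_ dj di]]].
  exists j; split=> // [|i ij _].
    by have := d j; rewrite eqxx => /eqP->.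
  by have := d i; rewrite (negbTE ij) => /eqP->.
exists j; apply/andP; split.
  apply/forallP => i; case: (eqVneq i j) => [->|/di/(_ isT)].
    by move: dj; case: (x j != y j).
  by case: (x i != y i).
move: dj; move: (x j) (y j) => [[|[|[|//]]] ?] [[|[|[|//]]] ?] //.
Qed.

Definition cube_cons {n} (d : 'I_3) (x : cube n) : cube n.+1 :=
  [ffun i => if unlift ord0 i is Some i' then x i' else d].

Definition cube_tail {n} (x : cube n.+1) : cube n := [ffun i => x (lift ord0 i)].

Lemma cube_cons0 n d (x : cube n) : cube_cons d x ord0 = d.
Proof. by rewrite ffunE unlift_none. Qed.

Lemma cube_consS n d (x : cube n) i : cube_cons d x (lift ord0 i) = x i.
Proof. by rewrite ffunE liftK. Qed.

Lemma cube_consK n d (x : cube n) : cube_tail (cube_cons d x) = x.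
Proof. by apply/ffunP => i; rewrite ffunE cube_consS. Qed.

Lemma cube_tailK n (x : cube n.+1) : cube_cons (x ord0) (cube_tail x) = x.
Proof.
apply/ffunP => i; case: (unliftP ord0 i) => [j ->|->].
  by rewrite cube_consS ffunE.
by rewrite cube_cons0.
Qed.

Lemma sum_cubeS n (F : cube n.+1 -> nat) :
  \sum_x F x = \sum_(d < 3) \sum_x F (cube_cons d x).
Proof.
rewrite pair_bigA /=.
apply: (reindex (fun p : 'I_3 * cube n => cube_cons p.1 p.2)).
exists (fun x : cube n.+1 => (x ord0, cube_tail x)) => [[d x] _|x _] /=.
  by rewrite cube_cons0 cube_consK.
exact: cube_tailK.
Qed.

Lemma Q3_adj_cons n d d' (x y : cube n) :
  Q3_adj (cube_cons d x) (cube_cons d' y) =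
  (d == d') * Q3_adj x y + (d != d') * (x == y) :> nat.
Proof.
rewrite !Q3_adjE {1}/hamming big_ord_recl !cube_cons0.
under eq_bigr do rewrite !cube_consS.
rewrite -/(hamming x y); case: (d == d'); first by rewrite add0n mul1n mul0n addn0.
rewrite add1n eqSS mul0n mul1n add0n; congr nat_of_bool.
apply/idP/eqP => [|->]; last by rewrite /hamming big1 // => i _; rewrite eqxx.
rewrite sum_nat_eq0 => /forallP h; apply/ffunP => i; apply/eqP.
by have := h i; case: (x i == y i).
Qed.

(** A neighbour either keeps the digit [d] and moves in the tail, or keeps the tail and changes [d].
    Degrees, inner pairs and lengths are all computed from this splitting. *)
Lemma sum_Q3_adj_cons n d (x : cube n) (F : cube n.+1 -> nat) :
  \sum_y Q3_adj (cube_cons d x) y * F y =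
  \sum_y Q3_adj x y * F (cube_cons d y)
  + \sum_(d' < 3) (d != d') * F (cube_cons d' x).
Proof.
rewrite sum_cubeS.
have slice d' : \sum_y Q3_adj (cube_cons d x) (cube_cons d' y) * F (cube_cons d' y) =
    (d == d') * (\sum_y Q3_adj x y * F (cube_cons d' y)) +
    (d != d') * (\sum_y (x == y) * F (cube_cons d' y)).
  rewrite !big_distrr -big_split; apply: eq_bigr => y _ /=.
  by rewrite Q3_adj_cons mulnDl !mulnA.
rewrite (eq_bigr _ (fun d' _ => slice d')).
rewrite big_split /=; congr (_ + _).
  rewrite (bigD1 d) //= eqxx mul1n [X in _ + X]big1 ?addn0 // => i.
  by rewrite eq_sym => /negbTE->.
apply: eq_bigr => d' _; congr (_ * _).
rewrite (bigD1 x) //= eqxx mul1n [X in _ + X]big1 ?addn0 // => i.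
by rewrite eq_sym => /negbTE->.
Qed.

Lemma Q3_degree n (x : cube n) : \sum_y Q3_adj x y = 2 * n.
Proof.
elim: n x => [|n IH] x.
  by rewrite big1 // => y _; rewrite Q3_adjE /hamming big_ord0.
rewrite -[x]cube_tailK.
under eq_bigr do rewrite -[nat_of_bool _]muln1.
rewrite sum_Q3_adj_cons; under eq_bigr do rewrite muln1.
rewrite IH !big_ord_recl big_ord0 /=.
case: (x ord0) => [[|[|[|//]]] ?] /=; lia.
Qed.

(** Pairs are ordered, so this is twice the number of edges inside [S]. *)
Definition inner_pairs {n} (S : pred (cube n)) : nat :=
  \sum_x \sum_y Q3_adj x y * (S x && S y).

Lemma inner_pairs_cons n (S : pred (cube n.+1)) :
  let slice d : pred (cube n) := fun x => S (cube_cons d x) in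
  inner_pairs S = \sum_(d < 3) inner_pairs (slice d)
    + \sum_(d < 3) \sum_(d' < 3) (d != d') * \sum_x (slice d x && slice d' x).
Proof.
rewrite /inner_pairs sum_cubeS -big_split /=; apply: eq_bigr => d _.
under eq_bigr => x _ do rewrite sum_Q3_adj_cons.
rewrite big_split exchange_big /=; congr (_ + _).
by rewrite exchange_big; apply: eq_bigr => d' _; rewrite big_distrr.
Qed.

(* Lindsey's theorem: initial segments of the lexicographic order span the
   most edges. *)
Lemma inner_pairs_le n (S : pred (cube n)) :
  inner_pairs S <= 2 * lex_edges (\sum_x S x).
Proof.
elim: n S => [|n IH] S.
  rewrite /inner_pairs big1 // => x _; rewrite big1 // => y _.
  by rewrite Q3_adjE /hamming big_ord0.
pose sl (d : 'I_3) (x : cube n) := S (cube_cons d x).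
pose c d := \sum_x sl d x; pose ip d := inner_pairs (sl d).
pose cap d d' := \sum_x (sl d x && sl d' x).
(* The edges between two slices form a matching, indexed by the tails common to both. *)
have capE d d' : cap d d' <= minn (c d) (c d').
  by rewrite leq_min; apply/andP; split; apply: leq_sum => x _;
     case: (sl d x); case: (sl d' x).
have ipE d : ip d <= 2 * lex_edges (c d) by exact: IH.
have -> : inner_pairs S =
    \sum_(d < 3) ip d + \sum_(d < 3) \sum_(d' < 3) (d != d') * cap d d'.
  exact: inner_pairs_cons.
have -> : \sum_x S x = \sum_(d < 3) c d by exact: sum_cubeS.
clearbody c ip cap.
rewrite !big_ord_recl !big_ord0 /=.
set d0 := ord0; set d1 := lift _ _; set d2 := lift _ _.
have := lex_edges_superadd (c d0) (c d1) (c d2).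
have := ipE d0; have := ipE d1; have := ipE d2.
have := capE d0 d1; have := capE d0 d2; have := capE d1 d2.
have := capE d1 d0; have := capE d2 d0; have := capE d2 d1.
rewrite (minnC (c d1) (c d0)) (minnC (c d2) (c d0)) (minnC (c d2) (c d1)).
rewrite !addn0 !mul0n !mul1n !addnA.
move: (minn _ _) (minn _ _) (minn _ _) => u v w.
move: (lex_edges (_ + _ + _)) => t; lia.
Qed.

(** * Length of the lexicographic numbering *)

Definition cube_val {n} (x : cube n) : nat := \sum_(i < n) x i * 3 ^ i.

Lemma cube_val_cons n d (x : cube n) :
  cube_val (cube_cons d x) = d + 3 * cube_val x.
Proof.
rewrite /cube_val big_ord_recl cube_cons0 muln1; congr (_ + _).
by rewrite big_distrr; apply: eq_bigr => i _; rewrite cube_consS expnS /= mulnCA.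
Qed.

Lemma cube_val_lt n (x : cube n) : cube_val x < 3 ^ n.
Proof.
elim: n x => [|n IH] x; first by rewrite /cube_val big_ord0.
rewrite -[x]cube_tailK cube_val_cons expnS.
have := IH (cube_tail x); have := ltn_ord (x ord0); lia.
Qed.

Lemma cube_val_inj n : injective (@cube_val n).
Proof.
elim: n => [|n IH] x y; first by move=> _; apply/ffunP => -[].
rewrite -[x]cube_tailK -[y]cube_tailK !cube_val_cons => e.
have := ltn_ord (x ord0); have := ltn_ord (y ord0) => y3 x3.
have -> : x ord0 = y ord0 by apply: val_inj => /=; lia.
by congr (cube_cons _ _); apply: IH; lia.
Qed.

(* Over ordered pairs, truncated subtraction counts each edge {x, y} once, with
   weight |v x - v y|. *)
Definition truncated_length {n} (v : cube n -> nat) : nat :=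
  \sum_x \sum_y Q3_adj x y * (v y - v x).

(** One more dimension gives three slices with the numbering scaled by 3, plus a triangle of weight
    1 + 1 + 2 for each of the [3 ^ n] tails. The factor 3 avoids a division. *)
Lemma truncated_length_val n :
  3 * truncated_length (@cube_val n) = 2 * 3 ^ n * (3 ^ n - 1).
Proof.
elim: n => [|n IH].
  rewrite /truncated_length big1 // => x _; rewrite big1 // => y _.
  by rewrite Q3_adjE /hamming big_ord0.
suff E : truncated_length (@cube_val n.+1) =
    9 * truncated_length (@cube_val n) + 4 * 3 ^ n.
  have := expn_gt0 3 n => /= h; rewrite E expnS; nia.
have c1 : \sum_(x : cube n) 1 = 3 ^ n by rewrite sum1_card card_ffun !card_ord.
have step d : \sum_(x : cube n) \sum_y Q3_adj (cube_cons d x) y *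
      (cube_val y - cube_val (cube_cons d x)) =
    3 * truncated_length (@cube_val n) + 3 ^ n * \sum_(d' < 3) (d' - d).
  under eq_bigr => x _ do rewrite sum_Q3_adj_cons.
  rewrite big_split /=; congr (_ + _).
    rewrite big_distrr; apply: eq_bigr => x _.
    rewrite big_distrr; apply: eq_bigr => y _ /=.
    by rewrite !cube_val_cons subnDl -mulnBr mulnCA.
  rewrite -c1 big_distrl; apply: eq_bigr => x _; rewrite /= mul1n.
  apply: eq_bigr => d' _; rewrite !cube_val_cons subnDr.
  by case: (eqVneq d d') => [->|_] /=; rewrite ?subnn ?muln0 ?mul1n.
rewrite [LHS]/truncated_length sum_cubeS.
rewrite (eq_bigr _ (fun d _ => step d)).
by rewrite !big_ord_recl !big_ord0 /= /bump /=; lia.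
Qed.

(** Edges along coordinate 0 have weight 0, and each of the three slices repeats the numbering
    [cube_val] of dimension [n]. *)
Lemma truncated_length_tail n :
  truncated_length (fun x : cube n.+1 => cube_val (cube_tail x)) =
  2 * 3 ^ n * (3 ^ n - 1).
Proof.
rewrite -truncated_length_val [LHS]/truncated_length sum_cubeS.
have step d : \sum_(x : cube n) \sum_y Q3_adj (cube_cons d x) y *
      (cube_val (cube_tail y) - cube_val (cube_tail (cube_cons d x))) =
    truncated_length (@cube_val n).
  rewrite /truncated_length; apply: eq_bigr => x _.
  rewrite sum_Q3_adj_cons [X in _ + X]big1 ?addn0.
    by apply: eq_bigr => y _; rewrite !cube_consK.
  by move=> d' _; rewrite !cube_consK subnn muln0.
rewrite (eq_bigr _ (fun d _ => step d)).
by rewrite sum_nat_const card_ord.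
Qed.

(** * Layouts on the caterpillar *)

Lemma dist_le_walk (G : sgraph) (x : G) (p : seq G) :
  path (@adj G) x p -> dist x (last x p) <= size p.
Proof.
move=> xp; rewrite /dist; set s := iota _ _; set a := fun _ => _.
case: (ltnP (size p) (find a s)) => // lt_p.
have := before_find 0 lt_p; rewrite nth_iota; last first.
  by apply: leq_trans lt_p _; rewrite -[X in _ <= X](size_iota 0) find_size.
by rewrite add0n /a => /existsP[]; exists (in_tuple p); rewrite /= xp eqxx.
Qed.

(** Descent builds a walk of [D x y] edges; the step inequality shows that no walk is shorter. *)
Lemma dist_eq (G : sgraph) (D : G -> G -> nat) :
  (forall x, D x x = 0) ->
  (forall x y z, adj x y -> D x z <= (D y z).+1) ->
  (forall x z, x != z -> exists2 y, adj x y & D x z = (D y z).+1) ->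
  (forall x y, D x y <= #|G|) ->
  forall x y, dist x y = D x y.
Proof.
move=> D0 Dstep Ddesc DG x y; apply/eqP; rewrite eqn_leq; apply/andP; split.
  have [p xp [<- <-]] : exists2 p, path (@adj G) x p & last x p = y /\ size p = D x y.
    elim: (D x y) {-2}x (erefl (D x y)) => [|k IH] z Dz;
      case: (eqVneq z y) Dz => [->|/Ddesc[w zw ->]].
    - by exists [::].
    - by [].
    - by rewrite D0.
    - by move=> [] /IH[p wp [lp sp]]; exists (w :: p); rewrite /= ?zw // lp sp.
  exact: dist_le_walk.
have walk p z : path (@adj G) z p -> D z (last z p) <= size p.
  elim: p z => [|w p IH] z /=; first by rewrite D0.
  by case/andP=> zw /IH; rewrite -ltnS; apply/leq_trans/Dstep.
rewrite /dist; set s := iota _ _; set a := fun _ => _.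
(* If the search fails, [find] returns the length [#|G|] of the list, which still bounds [D x y]
   from above. *)
have [has_a|no_a] := boolP (has a s); last first.
  move: no_a; rewrite has_find -leqNgt size_iota; exact: leq_trans.
have lt_a : find a s < #|G| by move: has_a; rewrite has_find size_iota.
have := nth_find 0 has_a; rewrite nth_iota // add0n.
by case/existsP=> p /andP[/walk + /eqP e]; rewrite e size_tuple.
Qed.

Section CaterpillarDistance.
Variables m k : nat.
Local Notation T := (caterpillar m k).

Definition anchor (t : T) : nat :=
  match t with inl i => i | inr (i, _) => i end.

Definition is_leaf (t : T) : bool := if t is inr _ then true else false.

(** Without the equality test a leaf would be at distance 2 from itself. The two truncated
    differences add up to an absolute value. *)
Definition cat_dist (s t : T) : nat :=
  if s == t then 0
  else is_leaf s + is_leaf t + ((anchor s - anchor t) + (anchor t - anchor s)).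

Lemma anchor_lt t : anchor t < m.
Proof. by case: t => [i|[i l]] /=. Qed.

Lemma cat_dist_step (x y z : T) : adj x y -> cat_dist x z <= (cat_dist y z).+1.
Proof.
rewrite /cat_dist; case: (eqVneq x z) => [//|xz].
case: (eqVneq y z) => [<-|yz].
  by case: x xz => [i|[i a]] xz; case: y => [j|[j b]] //=; try (move/eqP=> ->); lia.
by case: x xz => [i|[i a]] xz; case: y yz => [j|[j b]] yz //=; try (move/eqP=> ->); lia.
Qed.

(** A leaf moves to its backbone vertex, a backbone vertex moves towards the anchor of [z], and from
    that anchor only the leaf [z] remains to be reached. *)
Lemma cat_dist_desc (x z : T) :
  x != z -> exists2 y, adj x y & cat_dist x z = (cat_dist y z).+1.
Proof.
move=> xz; rewrite /cat_dist (negbTE xz).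
case: x xz => [i|[i a]] xz; last first.
  exists (inl i : T); first by rewrite /= eqxx.
  by case: eqVneq => [<-|_] /=; lia.
have := anchor_lt z => zm.
case: (ltngtP i (anchor z)) => iz.
- have im : i.+1 < m by lia.
  exists (inl (Ordinal im) : T); first by rewrite /= eqxx.
  by case: eqVneq iz => [<-|_] /=; lia.
- have im : i.-1 < m by have := ltn_ord i; lia.
  exists (inl (Ordinal im) : T); first by rewrite /=; lia.
  by case: eqVneq iz => [<-|_] /=; lia.
- case: z iz xz {zm} => [j|[j b]] /= iz xz.
    by case/eqP: xz; congr inl; exact: val_inj.
  exists (inr (j, b) : T); first by apply/eqP/val_inj.
  by rewrite eqxx; lia.
Qed.

Lemma dist_caterpillar (x y : T) : 0 < k -> dist x y = cat_dist x y.
Proof.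
move=> k0; apply: dist_eq => {x y} [x|||x y].
- by rewrite /cat_dist eqxx.
- exact: cat_dist_step.
- exact: cat_dist_desc.
(* The largest possible value is 2 + (m - 1), which is at most m + m * k because [0 < k]. *)
rewrite card_sum card_prod !card_ord /cat_dist.
case: eqVneq => // _; have := anchor_lt x; have := anchor_lt y.
by case: (is_leaf x); case: (is_leaf y) => /=; nia.
Qed.

Lemma sum_leaves : \sum_(t : T) is_leaf t = m * k.
Proof.
rewrite big_sumType /= big1 // add0n.
by rewrite sum_nat_const muln1 card_prod !card_ord.
Qed.

Lemma sum_anchor_lt i : i <= m -> \sum_(t : T) (anchor t < i) = i * k.+1.
Proof.
move=> im.
have below : \sum_(j < m) (j < i) = i.
  rewrite -big_mkcond /= (big_ord_narrow im) sum_nat_const muln1; exact: card_ord.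
have leaves : \sum_(p : 'I_m * 'I_k) (anchor (inr p) < i) =
    \sum_(j < m) \sum_(l < k) (j < i).
  by rewrite pair_bigA; apply: eq_bigr => -[].
rewrite big_sumType /= below leaves.
under eq_bigr do rewrite sum_nat_const card_ord.
by rewrite -big_distrr /= below mulnS mulnC.
Qed.

End CaterpillarDistance.

Arguments anchor {m k} t.
Arguments is_leaf {m k} t.

(** Swapping endpoints turns the terms [H y x] into a sum over the pairs with the opposite rank
    order, so both halves together run over all ordered adjacent pairs. *)
Lemma sum_edges_orient (G : sgraph) (F H : G -> G -> nat) :
  (forall x y, adj x y -> F x y = H x y + H y x) ->
  \sum_(e : G * G | adj e.1 e.2 && (enum_rank e.1 < enum_rank e.2)) F e.1 e.2 =
  \sum_x \sum_y adj x y * H x y.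
Proof.
move=> FH.
rewrite (eq_bigr (fun e => H e.1 e.2 + H e.2 e.1)); last first.
  by move=> e /andP[e_adj _]; exact: FH.
rewrite big_split /= pair_bigA /=.
rewrite [RHS](bigID (fun e : G * G => enum_rank e.1 < enum_rank e.2)) /=.
have maskE (P : pred (G * G)) : \sum_(e | P e) adj e.1 e.2 * H e.1 e.2 =
    \sum_(e | adj e.1 e.2 && P e) H e.1 e.2.
  rewrite [LHS]big_mkcond [RHS]big_mkcond; apply: eq_bigr => e _ /=.
  by case: (adj _ _); case: (P e); rewrite /= ?mul1n.
rewrite !maskE; congr (_ + _).
rewrite (reindex (fun e : G * G => (e.2, e.1))) /=; last first.
  by exists (fun e => (e.2, e.1)) => -[].
apply: eq_bigl => -[x y] /=; rewrite adj_sym -leqNgt.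
case: (boolP (adj x y)) => //= xy; rewrite ltn_neqAle.
case: eqP => // /val_inj/enum_rank_inj exy.
by rewrite exy adj_irr in xy.
Qed.

Lemma sum_Q3_adj_left n (F : cube n -> nat) :
  \sum_x \sum_y Q3_adj x y * F x = 2 * n * \sum_x F x.
Proof.
rewrite big_distrr; apply: eq_bigr => x _.
by rewrite -big_distrl /= Q3_degree.
Qed.

(** Each vertex placed on a leaf pays 1 for each of its [2 * n] cube edges, whatever the layout;
    only the anchors can be optimised. *)
Lemma WLf_Q3 n m k (f : Q3 n -> caterpillar m k) : 0 < k -> bijective f ->
  WLf f = 2 * n * (m * k) + truncated_length (fun x => anchor (f x)).
Proof.
move=> k0 bij_f; rewrite /WLf.
rewrite (sum_edges_orient _ (fun x y => dist (f x) (f y))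
  (fun x y => is_leaf (f x) + (anchor (f y) - anchor (f x)))); last first.
  move=> x y xy; rewrite dist_caterpillar // /cat_dist.
  rewrite (inj_eq (bij_inj bij_f)); case: eqVneq => [exy|_]; last by lia.
  by rewrite exy adj_irr in xy.
have leavesE : \sum_x is_leaf (f x) = m * k.
  by rewrite -sum_leaves [RHS](reindex f) //; exact: onW_bij.
rewrite -leavesE -sum_Q3_adj_left /truncated_length -big_split; apply: eq_bigr => x _.
by rewrite -big_split; apply: eq_bigr => y _; rewrite mulnDr.
Qed.

Lemma sum_between N p q : q < N -> \sum_(i < N) ((p < i) && (i <= q)) = q - p.
Proof.
(* The form with [minn] needs no bound on [q], so induction on [N] goes through. *)
suff -> : \sum_(i < N) ((p < i) && (i <= q)) = minn q N.-1 - p by lia.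
elim: N => [|N IH]; first by rewrite big_ord0; lia.
rewrite big_ord_recr /= IH; lia.
Qed.

(* The part of the length carried by the backbone is the sum over backbone
   edges of the number of cube edges they separate. *)
Lemma truncated_length_ge m (f : Q3 m.+1 -> caterpillar (3 ^ m) 2) :
  bijective f ->
  2 * 3 ^ m * (3 ^ m - 1) <= truncated_length (fun x => anchor (f x)).
Proof.
move=> bij_f; pose b x := anchor (f x).
(* For positive [i] these are the cube edges across the backbone edge from [i - 1] to [i], each
   counted in one orientation; [cut 0] is zero. *)
pose cut i := \sum_x \sum_y Q3_adj x y * ((b x < i) && (i <= b y)).
have cutE : truncated_length b = \sum_(i < 3 ^ m) cut i.
  rewrite /cut exchange_big; apply: eq_bigr => x _.
  rewrite exchange_big; apply: eq_bigr => y _.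
  by rewrite -big_distrr /= sum_between // anchor_lt.
have cut_ge i : i < 3 ^ m -> 6 * m.+1 * i <= cut i + 2 * lex_edges (3 * i).
  move=> iN; have size_S : \sum_x (b x < i) = 3 * i.
    rewrite mulnC -(sum_anchor_lt _ 2 i (ltnW iN)) [RHS](reindex f) //.
    exact: onW_bij.
  have := inner_pairs_le _ (fun x => b x < i); rewrite size_S => in_le.
  (* The degrees of the [3 * i] vertices on the low side count each crossing edge once and each
     inner edge twice. *)
  have -> : 6 * m.+1 * i = cut i + inner_pairs (fun x => b x < i).
    rewrite (_ : 6 * _ * _ = 2 * m.+1 * (3 * i)); last by lia.
    rewrite -size_S -sum_Q3_adj_left /cut /inner_pairs -big_split.
    apply: eq_bigr => x _; rewrite -big_split; apply: eq_bigr => y _ /=.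
    rewrite -mulnDr; congr (_ * _).
    by case: (b x < i) => //=; case: leqP.
  by rewrite leq_add2l.
have total : 6 * m.+1 * (\sum_(i < 3 ^ m) i) <=
    \sum_(i < 3 ^ m) cut i + 2 * \sum_(i < 3 ^ m) lex_edges (3 * i).
  rewrite !big_distrr -big_split; apply: leq_sum => i _; exact: cut_ge.
by rewrite -/b cutE; have := sum_lex_edges_mul3 m; lia.
Qed.

Definition digit_vertex {N} (d : 'I_3) (i : 'I_N) : caterpillar N 2 :=
  match val d with 0 => inl i | 1 => inr (i, ord0) | _ => inr (i, ord_max) end.

Lemma digit_vertex_inj N d d' (i j : 'I_N) :
  digit_vertex d i = digit_vertex d' j -> d = d' /\ i = j.
Proof.
case: d d' => [[|[|[|//]]] ?] [[|[|[|//]]] ?] //= [->]; split=> //; exact: val_inj.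
Qed.

Lemma anchor_digit_vertex N d (i : 'I_N) : anchor (digit_vertex d i) = i.
Proof. by case: d => [[|[|[|//]]] ?]. Qed.

(** The tail selects the backbone vertex and coordinate 0 one of the three places there, so
    lexicographically consecutive triples share an anchor. *)
Definition lex_layout {m} (x : Q3 m.+1) : caterpillar (3 ^ m) 2 :=
  digit_vertex ((x : cube m.+1) ord0) (Ordinal (cube_val_lt _ (cube_tail x))).

Lemma lex_layout_inj m : injective (@lex_layout m).
Proof.
move=> x y /digit_vertex_inj[e0 /(congr1 val) /= /cube_val_inj et].
by rewrite -[x](@cube_tailK m) -[y](@cube_tailK m) e0 et.
Qed.

Theorem theorem5p4 (n : nat) (hn : 1 <= n) :
  WL (Q3 n) (twoCAT n) (card_Q3_twoCAT hn) =
    2 * 3 ^ (n - 1) * (3 ^ (n - 1) - 1) + (4 * n) * 3 ^ (n - 1).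
Proof.
rewrite /WL; case: ex_minnP => w.
case/existsP=> f /andP[/andP[/injectiveP inj_f _] /eqP WLf_w] w_min.
have cardE := card_Q3_twoCAT hn.
case: n hn cardE f inj_f WLf_w w_min => // m hn; rewrite /twoCAT subn1 /=.
move=> cardE f inj_f WLf_w w_min.
apply/eqP; rewrite eqn_leq; apply/andP; split.
  (* Upper bound: [lex_layout] as a finite function is a competitor for the minimum. *)
  pose g : {ffun Q3 m.+1 -> caterpillar (3 ^ m) 2} := [ffun x => lex_layout x].
  have gE : g =1 lex_layout by move=> x; rewrite ffunE.
  have inj_g : injective g by move=> x y; rewrite !gE; exact: lex_layout_inj.
  have bij_g : bijective g by apply: inj_card_bij; rewrite // cardE.
  suff WLg : WLf g = 2 * 3 ^ m * (3 ^ m - 1) + 4 * m.+1 * 3 ^ m.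
    rewrite -WLg; apply: w_min; apply/existsP; exists g; rewrite eqxx andbT.
    apply/andP; split; first exact/injectiveP.
    by apply/forallP => t; apply: inj_card_onto; rewrite // cardE.
  rewrite WLf_Q3 // -truncated_length_tail addnC; congr (_ + _); last by lia.
  rewrite /truncated_length; apply: eq_bigr => x _; apply: eq_bigr => y _.
  by rewrite !gE !anchor_digit_vertex.
(* Lower bound, applied to the minimising layout [f]. *)
have bij_f : bijective f by apply: inj_card_bij; rewrite // cardE.
rewrite -WLf_w WLf_Q3 //; have := truncated_length_ge _ _ bij_f; lia.
Qed.
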